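(* Let $k\geq 0$ be a fixed integer. For $n\ge k$ let $S_{n-k}$ denote the subgroup of the symmetric group $S_n$ consisting of all $\sigma$ with $\sigma(i)=i$ for all $i\in[k]$; it acts on $\binom{[n]}{2}$ by $\sigma\cdot\{i,j\}=\{\sigma(i),\sigma(j)\}$. Suppose $(A^{(n)})_{n\geq k}$ is a sequence of real symmetric matrices such that: (i) $A^{(n)}\in\mathbb{R}^{\binom{[n]}{2}\times\binom{[n]}{2}}$ for each $n\geq k$; (ii) for all $n,n'$ with $k\leq n'\leq n$ and all $e_i,e_j\in\binom{[n']}{2}$, $A^{(n')}_{e_i,e_j}=A^{(n)}_{e_i,e_j}$; (iii) for all $n\geq k$, $A^{(n)}$ is invariant under the simultaneous action of $S_{n-k}$ on rows and columns, i.e. $A^{(n)}_{\sigma\cdot e,\sigma\cdot f}=A^{(n)}_{e,f}$ for all $\sigma\in S_{n-k}$, $e,f\in\binom{[n]}{2}$. Write $a_{(e,f)}$ for the $(e,f)$-entry of $A^{(k+4)}$, $e,f\in\binom{[k+4]}{2}$. Then $A^{(n)}$ is positive semidefinite for every $n\geq k$ if and only if all of the following hold: (1) $a_{(\{k+1,k+2\},\{k+1,k+2\})}-2a_{(\{k+1,k+2\},\{k+1,k+3\})}+a_{(\{k+1,k+2\},\{k+3,k+4\})}\geq 0$; (2) the symmetric matrix with rows/columns indexed by $\binom{[k]}{2}$, then $[k]$, then one extra index $*$, with blocks $$\begin{pmatrix} C_{11} & C_{12} & C_{13}\\ C_{12}^{\sf T} & C_{22}' & C_{23}'\\ C_{13}^{\sf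 T} & (C_{23}')^{\sf T} & C_{33}'\end{pmatrix},$$ where $C_{11}=(a_{(e,f)})_{e,f\in\binom{[k]}{2}}$, $C_{12}=(a_{(e,\{j,k+1\})})_{e\in\binom{[k]}{2},\,j\in[k]}$, $C_{13}=(a_{(e,\{k+1,k+2\})})_{e\in\binom{[k]}{2}}$ (a column), $C_{22}'=(a_{(\{i,k+1\},\{j,k+2\})})_{i,j\in[k]}$, $C_{23}'=(a_{(\{i,k+1\},\{k+2,k+3\})})_{i\in[k]}$ (a column), and $C_{33}'=a_{(\{k+1,k+2\},\{k+3,k+4\})}$, is positive semidefinite; (3) the symmetric matrix with rows/columns indexed by $[k]$ then one extra index, with blocks $$\begin{pmatrix} D_{11} & D_{12}\\ D_{12}^{\sf T} & a_{(\{k+1,k+2\},\{k+1,k+3\})}-a_{(\{k+1,k+2\},\{k+3,k+4\})}\end{pmatrix},$$ where $D_{11}=\big(a_{(\{i,k+1\},\{j,k+1\})}-a_{(\{i,k+1\},\{j,k+2\})}\big)_{i,j\in[k]}$ and $D_{12}=\big(a_{(\{i,k+1\},\{k+1,k+2\})}-a_{(\{i,k+1\},\{k+2,k+3\})}\big)_{i\in[k]}$ (a column), is positive semidefinite.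
   Context: Blocks indexed by an empty set (e.g. when $k\le 1$) are omitted. *)

(* Defs.v *)
From HB Require Import structures.
From mathcomp Require Import all_boot all_order all_fingroup all_algebra.
From mathcomp Require Import reals.

Set Implicit Arguments.
Unset Strict Implicit.
Unset Printing Implicit Defensive.

Import Order.TTheory GRing.Theory Num.Theory.
Local Open Scope ring_scope.

(* Vertices are numbered from 0: [n] is 'I_n, and the vertex called i in 1-based
   notation is the ordinal of value i - 1. *)
Definition edge (n : nat) : Type := {e : {set 'I_n} | #|e| == 2%N}.
HB.instance Definition _ (n : nat) := SubType.on (edge n).
HB.instance Definition _ (n : nat) := Finite.on (edge n).

Fact edge_map_subproof (m n : nat) (f : 'I_m -> 'I_n) (f_inj : injective f)
  (e : edge m) : #|f @: val e| == 2%N.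
Proof. by rewrite card_imset //; exact: (valP e). Qed.

Definition edge_map (m n : nat) (f : 'I_m -> 'I_n) (f_inj : injective f)
  (e : edge m) : edge n := Sub (f @: val e) (edge_map_subproof f_inj e).

Fact widen_ord_injective (m n : nat) (le_mn : (m <= n)%N) :
  injective (widen_ord le_mn).
Proof. by move=> i j /(congr1 val) /= /val_inj. Qed.

Definition edge_widen (m n : nat) (le_mn : (m <= n)%N) : edge m -> edge n :=
  edge_map (@widen_ord_injective m n le_mn).

Definition edge_act (n : nat) (s : 'S_n) : edge n -> edge n :=
  edge_map (@perm_inj _ s).

Fact edge_pair_subproof (n : nat) (i j : 'I_n) (neq_ij : i != j) :
  #|[set i; j]| == 2%N.
Proof. by rewrite cards2 neq_ij. Qed.

Definition edge_pair (n : nat) (i j : 'I_n) (neq_ij : i != j) : edge n :=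
  Sub [set i; j] (edge_pair_subproof neq_ij).

(* S_{n-k}: the permutations of [n] that fix each of the first k points. *)
Definition fix_first (k n : nat) : {group 'S_n} :=
  'C([set i : 'I_n | (i < k)%N] | 'P)%G.

Definition entry (R : Type) (n : nat) (M : 'M[R]_#|{: edge n}|)
  (e f : edge n) : R := M (enum_rank e) (enum_rank f).

Definition psd (R : realType) (m : nat) (M : 'M[R]_m) : Prop :=
  M^T = M /\ forall x : 'cV[R]_m, 0 <= (x^T *m M *m x) 0 0.

(* In [k+4], [lshift 4 i] is the vertex i of [k], and [rshift k p1], ...,
   [rshift k p4] are the vertices k+1, ..., k+4. *)
Definition p1 : 'I_4 := @Ordinal 4 0 isT.
Definition p2 : 'I_4 := @Ordinal 4 1 isT.
Definition p3 : 'I_4 := @Ordinal 4 2 isT.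
Definition p4 : 'I_4 := @Ordinal 4 3 isT.

Definition old_edge (k : nat) : edge k -> edge (k + 4) :=
  edge_map (@lshift_inj k 4).

Fact mid_edge_subproof (k : nat) (i : 'I_k) (p : 'I_4) :
  lshift 4 i != rshift k p.
Proof. by rewrite eq_lrshift. Qed.

Definition mid_edge (k : nat) (i : 'I_k) (p : 'I_4) : edge (k + 4) :=
  edge_pair (mid_edge_subproof i p).

Fact new_edge_subproof (k : nat) (p q : 'I_4) (neq_pq : p != q) :
  rshift k p != rshift k q.
Proof. by rewrite eq_rshift. Qed.

Definition new_edge (k : nat) (p q : 'I_4) (neq_pq : p != q) : edge (k + 4) :=
  edge_pair (new_edge_subproof k neq_pq).

(* [epq k] is the edge {k+p, k+q}. *)
Definition e12 (k : nat) : edge (k + 4) := @new_edge k p1 p2 isT.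
Definition e13 (k : nat) : edge (k + 4) := @new_edge k p1 p3 isT.
Definition e23 (k : nat) : edge (k + 4) := @new_edge k p2 p3 isT.
Definition e34 (k : nat) : edge (k + 4) := @new_edge k p3 p4 isT.

Section Blocks.

Variables (R : realType) (k : nat) (a : edge (k + 4) -> edge (k + 4) -> R).

Definition C11 : 'M[R]_#|{: edge k}| :=
  \matrix_(e, f) a (old_edge (enum_val e)) (old_edge (enum_val f)).

Definition C12 : 'M[R]_(#|{: edge k}|, k) :=
  \matrix_(e, j) a (old_edge (enum_val e)) (mid_edge j p1).

Definition C13 : 'cV[R]_#|{: edge k}| :=
  \col_e a (old_edge (enum_val e)) (e12 k).

Definition C22' : 'M[R]_k :=
  \matrix_(i, j) a (mid_edge i p1) (mid_edge j p2).

Definition C23' : 'cV[R]_k := \col_i a (mid_edge i p1) (e23 k).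

Definition C33' : R := a (e12 k) (e34 k).

Definition C_mx : 'M[R]_(#|{: edge k}| + (k + 1)) :=
  block_mx C11                 (row_mx C12 C13)
           (col_mx C12^T C13^T) (block_mx C22' C23' C23'^T C33'%:M).

Definition D11 : 'M[R]_k :=
  \matrix_(i, j) (a (mid_edge i p1) (mid_edge j p1)
                  - a (mid_edge i p1) (mid_edge j p2)).

Definition D12 : 'cV[R]_k :=
  \col_i (a (mid_edge i p1) (e12 k) - a (mid_edge i p1) (e23 k)).

Definition D22 : R := a (e12 k) (e13 k) - a (e12 k) (e34 k).

Definition D_mx : 'M[R]_(k + 1) := block_mx D11 D12 D12^T D22%:M.

End Blocks.

(* Main.v *)
Require Import Defs.
From mathcomp Require Import all_boot all_order all_fingroup all_algebra.
From mathcomp Require Import reals ring.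
Import Order.TTheory GRing.Theory Num.Theory.
Local Open Scope ring_scope.

Set Implicit Arguments.
Unset Strict Implicit.
Unset Printing Implicit Defensive.

(* By invariance the entry at (e, f) depends only on how e and f meet [k] and on
   the vertices outside [k] that they share.  Summing over shared vertices gives
   A_(e,f) = C_(e,f) + sum_(v in e, f; v not in [k]) D_(e,f) + gap * [e = f, e
   disjoint from [k]], where gap is the expression in condition (1), and C and D
   are evaluated at the classes of e and f.  This exhibits A as a sum of
   positive semidefinite kernels.  Conversely, an edge family indexed by (p, t)
   whose entries are X(p,q) + [t = u] Y(p,q) forces Y to be positive
   semidefinite (take differences in t), and X as well if t ranges over
   arbitrarily large sets (average over t).  Suitable families isolate C, D and
   gap. *)

(** * Positive semidefinite kernels on finite types *)

Section PositiveKernels.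

Variable R : realType.

(** Symmetry is left out and treated separately; any finite index type is allowed, so kernels on
    edges or on pairs need no numbering. *)
Definition kpsd (I : finType) (K : I -> I -> R) : Prop :=
  forall x : I -> R, 0 <= \sum_i \sum_j x i * x j * K i j.

Lemma psd_kpsd n (M : 'M[R]_n) : psd M <-> M^T = M /\ kpsd M.
Proof.
have E (x : 'cV[R]_n) :
    (x^T *m M *m x) 0 0 = \sum_i \sum_j x i 0 * x j 0 * M i j.
  rewrite exchange_big mxE /=; apply: eq_bigr => j _; rewrite mxE mulr_suml.
  by apply: eq_bigr => i _; rewrite mxE mulrAC.
split=> -[sM pM]; split=> // x; last by rewrite E; apply: pM.
have := pM (\col_i x i); rewrite E; congr (_ <= _).
by apply: eq_bigr => i _; apply: eq_bigr => j _; rewrite !mxE.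
Qed.

Lemma eq_kpsd (I : finType) (K K' : I -> I -> R) :
  kpsd K -> (forall i j, K i j = K' i j) -> kpsd K'.
Proof.
move=> pK eqK x; have := pK x; congr (_ <= _).
by apply: eq_bigr => i _; apply: eq_bigr => j _; rewrite eqK.
Qed.

(** The form at [x] is the form of [K] at the pushforward of [x], obtained by summing over the
    fibres of [c]; so [c] may identify or miss indices. *)
Lemma kpsd_comp (I J : finType) (c : I -> J) (K : J -> J -> R) :
  kpsd K -> kpsd (fun i j => K (c i) (c j)).
Proof.
move=> pK x; have := pK (fun p => \sum_(i | c i == p) x i); congr (_ <= _).
rewrite [RHS](partition_big c xpredT) //=; apply: eq_bigr => p _.
transitivity (\sum_(i | c i == p) \sum_q x i * (\sum_(j | c j == q) x j) * K p q).
  by rewrite exchange_big /=; apply: eq_bigr => q _; rewrite !mulr_suml.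
apply: eq_bigr => i /eqP <-; rewrite [RHS](partition_big c xpredT) //=.
apply: eq_bigr => q _; rewrite mulr_sumr mulr_suml.
by apply: eq_bigr => j /eqP <-.
Qed.

Lemma kpsd_add (I : finType) (K K' : I -> I -> R) :
  kpsd K -> kpsd K' -> kpsd (fun i j => K i j + K' i j).
Proof.
move=> pK pK' x; have := addr_ge0 (pK x) (pK' x); congr (_ <= _).
rewrite -big_split; apply: eq_bigr => i _ /=.
by rewrite -big_split; apply: eq_bigr => j _ /=; rewrite mulrDr.
Qed.

Lemma kpsd_sum (I J : finType) (K : J -> I -> I -> R) :
  (forall v, kpsd (K v)) -> kpsd (fun i j => \sum_v K v i j).
Proof.
move=> pK x; have : 0 <= \sum_v \sum_i \sum_j x i * x j * K v i j.
  by apply: sumr_ge0 => v _; apply: pK.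
congr (_ <= _); rewrite exchange_big; apply: eq_bigr => i _ /=.
by rewrite exchange_big; apply: eq_bigr => j _ /=; rewrite mulr_sumr.
Qed.

Lemma kpsd_weight (I : finType) (w : I -> R) (K : I -> I -> R) :
  kpsd K -> kpsd (fun i j => w i * w j * K i j).
Proof.
move=> pK x; have := pK (fun i => x i * w i); congr (_ <= _).
by apply: eq_bigr => i _; apply: eq_bigr => j _; rewrite mulrACA !mulrA.
Qed.

Lemma kpsd_diag (I : finType) (d : I -> R) :
  (forall i, 0 <= d i) -> kpsd (fun i j => d i *+ (i == j)).
Proof.
move=> d_ge0 x; apply: sumr_ge0 => i _.
rewrite (bigD1 i) //= eqxx big1 ?addr0 => [|j /negPf]; last first.
  by rewrite eq_sym => ->; rewrite mulr0.
by apply: mulr_ge0; [rewrite -expr2 sqr_ge0 | apply: d_ge0].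
Qed.

Lemma sum_pair (I T : finType) (F : I * T -> I * T -> R) :
  \sum_i \sum_j F i j
  = \sum_i \sum_j \sum_t \sum_u F (i, t) (j, u).
Proof.
transitivity (\sum_i \sum_t \sum_j \sum_u F (i, t) (j, u)).
  rewrite [RHS]pair_big /=; apply: eq_bigr => -[i t] _ /=.
  by rewrite [RHS]pair_big /=; apply: eq_bigr => -[j u] _.
by apply: eq_bigr => i _; rewrite exchange_big.
Qed.

(** On a product vector, [X] sees only the total of [y] and [Y] only its squared norm. The choice of
    [y] then isolates one of the two. *)
Lemma sum_tensor (I T : finType) (X Y : I -> I -> R) (x : I -> R) (y : T -> R) :
  \sum_i \sum_j (x i.1 * y i.2) * (x j.1 * y j.2)
    * (X i.1 j.1 + Y i.1 j.1 *+ (i.2 == j.2))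
  = (\sum_t y t) ^+ 2 * (\sum_i \sum_j x i * x j * X i j)
    + (\sum_t y t ^+ 2) * (\sum_i \sum_j x i * x j * Y i j).
Proof.
rewrite sum_pair /= !mulr_sumr -big_split; apply: eq_bigr => i _ /=.
rewrite !mulr_sumr -big_split; apply: eq_bigr => j _ /=.
rewrite expr2 !mulr_suml -big_split; apply: eq_bigr => t _ /=.
rewrite mulr_sumr mulr_suml.
under eq_bigr => u _ do rewrite mulrDr.
rewrite big_split /=; congr (_ + _).
  by apply: eq_bigr => u _; rewrite mulrACA (mulrC (x i * x j)) !mulrA.
rewrite (bigD1 t) //= eqxx big1 ?addr0 => [|u /negPf]; last first.
  by rewrite eq_sym => ->; rewrite mulr0.
by rewrite mulrACA (mulrC (x i * x j)) -expr2 !mulrA.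
Qed.

(** Weight 1 on copy [t] and -1 on copy [u] has total 0, which removes [X]. *)
Lemma kpsd_diff (I T : finType) (X Y : I -> I -> R) (t u : T) : t != u ->
  kpsd (fun i j : I * T => X i.1 j.1 + Y i.1 j.1 *+ (i.2 == j.2)) -> kpsd Y.
Proof.
move=> neq_tu pK x.
have := pK (fun i => x i.1 * ((i.2 == t)%:R - (i.2 == u)%:R)).
rewrite (sum_tensor X Y x (fun v => (v == t)%:R - (v == u)%:R)).
have S1 (w : T) : \sum_v (v == w)%:R = 1 :> R.
  by rewrite (bigD1 w) //= eqxx big1 ?addr0 // => v /negPf ->.
rewrite sumrB !S1 subrr expr0n mul0r add0r pmulr_rge0 //.
(* The squared norm of the weight is positive: the copy [t] alone contributes 1. *)
rewrite (bigD1 t) //= eqxx (negPf neq_tu) subr0 expr1n ltr_pwDl //.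
by apply: sumr_ge0 => v _; rewrite sqr_ge0.
Qed.

Lemma ge0_of_harmonic (a b : R) :
  (forall N, (1 < N)%N -> 0 <= a + N%:R^-1 * b) -> 0 <= a.
Proof.
move=> H; rewrite leNgt; apply/negP => a_lt0.
(* One successor would already exceed [b / - a]; the second one also ensures [1 < N]. *)
pose N := (Num.truncn (b / - a)).+2.
have := H N isT; rewrite leNgt => /negP; apply.
have N_gt0 : 0 < N%:R :> R by rewrite ltr0n.
rewrite -(pmulr_rlt0 _ N_gt0) mulrDr mulrA divff ?gt_eqF // mul1r.
rewrite addrC -(opprK a) mulrN subr_lt0 -ltr_pdivrMr ?oppr_gt0 //.
by apply: lt_trans (truncnS_gt _) _; rewrite ltr_nat.
Qed.

(** The uniform weight 1/N on the copies has total 1 and squared norm 1/N, so the contribution of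
    [Y] vanishes as N grows. *)
Lemma kpsd_limit (I : finType) (X Y : I -> I -> R) :
  (forall N, (1 < N)%N ->
     kpsd (fun i j : I * 'I_N => X i.1 j.1 + Y i.1 j.1 *+ (i.2 == j.2))) ->
  kpsd X.
Proof.
move=> pK x; apply: (@ge0_of_harmonic _ (\sum_i \sum_j x i * x j * Y i j)) => N N_gt1.
have := pK N N_gt1 (fun i => x i.1 * N%:R^-1).
rewrite (sum_tensor X Y x (fun=> N%:R^-1)) !sumr_const card_ord.
have N_neq0 : N%:R != 0 :> R by rewrite pnatr_eq0 -lt0n ltnW.
have -> : N%:R^-1 *+ N = 1 :> R by rewrite -(mulr_natr (N%:R^-1)) mulVf.
have -> : N%:R^-1 ^+ 2 *+ N = N%:R^-1 :> R.
  by rewrite -(mulr_natr (N%:R^-1 ^+ 2)) expr2 mulfVK.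
by rewrite expr1n mul1r.
Qed.

End PositiveKernels.

(** * Extending lists and injections to permutations *)

Lemma uniq_extend_inj (m' m : nat) (s : seq 'I_m) :
  uniq s -> (size s <= m')%N -> (m' <= m)%N ->
  exists2 g : 'I_m' -> 'I_m, injective g &
    forall x0 (i : 'I_m'), (i < size s)%N -> g i = nth x0 s i.
Proof.
(* [s'] enumerates all of ['I_m] and starts with [s]; the injection reads off its first [m']
   elements. *)
move=> s_uniq le_s le_m; pose s' := s ++ enum [predC s].
have s'_uniq : uniq s'.
  rewrite cat_uniq s_uniq enum_uniq andbT /=; apply/hasPn => x.
  by rewrite mem_enum.
have size_s' : size s' = m.
  by rewrite size_cat -cardE -(card_uniqP s_uniq) cardC card_ord.
have lt_s' (i : 'I_m') : (i < size s')%N by rewrite size_s' (leq_trans (ltn_ord i)).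
(* The default of [nth] is never returned, since every index is below [size s']. *)
exists (fun i => nth (widen_ord le_m i) s' i) => [i j|x0 i lt_i].
  rewrite (set_nth_default (widen_ord le_m j) _ (lt_s' i)) => /eqP.
  by rewrite nth_uniq // => /eqP /val_inj.
by rewrite (set_nth_default x0 _ (lt_s' i)) nth_cat lt_i.
Qed.

(** The list of values of [g] extends to an injection of ['I_n] into itself, which is a
    permutation. *)
Lemma inj_extend_perm (m n : nat) (g : 'I_m -> 'I_n) (le_mn : (m <= n)%N) :
  injective g -> exists s : 'S_n, forall i, s (widen_ord le_mn i) = g i.
Proof.
move=> g_inj.
have [||h h_inj hE] := @uniq_extend_inj n n (codom g) _ _ (leqnn n).
- by rewrite map_inj_uniq ?enum_uniq.
- by rewrite size_codom card_ord.
exists (perm h_inj) => i; rewrite permE (hE (g i)) ?size_codom ?card_ord //=.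
by rewrite (nth_map i) ?size_enum_ord // nth_ord_enum.
Qed.

(** * Edges classified by their endpoints outside [k] *)

Section EdgeTypes.

Variable k : nat.

Fact mid_in_subproof m (i : 'I_k) (v : 'I_m) : lshift m i != rshift k v.
Proof. by rewrite eq_lrshift. Qed.

Fact new_in_subproof m (u v : 'I_m) : u != v -> rshift k u != rshift k v.
Proof. by rewrite eq_rshift. Qed.

Definition old_in m (o : edge k) : edge (k + m) := edge_map (@lshift_inj k m) o.

Definition mid_in m (i : 'I_k) (v : 'I_m) : edge (k + m) :=
  edge_pair (mid_in_subproof i v).

Definition new_in m (u v : 'I_m) (uv : u != v) : edge (k + m) :=
  edge_pair (new_in_subproof uv).

Variant edge_spec m : edge (k + m) -> Prop :=
  | OldEdge o : edge_spec (old_in m o)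
  | MidEdge i v : edge_spec (mid_in i v)
  | NewEdge u v (uv : u != v) : edge_spec (new_in uv).

Lemma edgeP m (e : edge (k + m)) : edge_spec e.
Proof.
have /cards2P [x [y [neq_xy def_e]]] := valP e.
case: (split_ordP x) neq_xy def_e => i ->; case: (split_ordP y) => j -> neq def_e.
- have neq_ij : i != j by rewrite -(inj_eq (@lshift_inj k m)).
  suff -> : e = old_in m (edge_pair neq_ij) by constructor.
  by apply: val_inj; rewrite def_e /= imsetU1 imset_set1.
- suff -> : e = mid_in i j by constructor.
  exact: val_inj.
- suff -> : e = mid_in j i by constructor.
  by apply: val_inj; rewrite def_e setUC.
- have neq_ij : i != j by rewrite -(inj_eq (@rshift_inj k m)).
  suff -> : e = new_in neq_ij by constructor.
  exact: val_inj.
Qed.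

Lemma new_inC m (u v : 'I_m) (uv : u != v) (vu : v != u) : new_in uv = new_in vu.
Proof. by apply: val_inj; rewrite /= setUC. Qed.

(** The extra index [*] of [D_mx]; shifted past the old edges, it is that of [C_mx]. *)
Definition star_index : 'I_(k + 1) := rshift k ord0.

(* [tail_index] is a junk value on edges inside [k]. *)
Definition tail_index m (e : edge (k + m)) : 'I_(k + 1) :=
  if [pick i | lshift m i \in val e] is Some i then lshift 1 i
  else star_index.

(** The row of [C_mx] belonging to an edge: it records the part of the edge inside [k] and forgets
    its new vertices. *)
Definition class_index m (e : edge (k + m)) : 'I_(#|{: edge k}| + (k + 1)) :=
  if [pick o | old_in m o == e] is Some o then lshift _ (enum_rank o)
  else rshift _ (tail_index e).

Definition touches m (v : 'I_m) (e : edge (k + m)) : bool :=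
  rshift k v \in val e.

Lemma touches_old m (v : 'I_m) (o : edge k) : touches v (old_in m o) = false.
Proof.
by apply/negbTE/imsetP => -[i _ /eqP]; rewrite eq_sym eq_lrshift.
Qed.

Lemma touches_mid m (w : 'I_m) i v : touches w (mid_in i v) = (w == v).
Proof. by rewrite /touches !inE eq_rlshift eq_rshift. Qed.

Lemma touches_new m (w u v : 'I_m) (uv : u != v) :
  touches w (new_in uv) = (w == u) || (w == v).
Proof. by rewrite /touches !inE !eq_rshift. Qed.

Lemma new_in_neq m (u v : 'I_m) (uv : u != v) w z (wz : w != z) :
  v != w -> v != z -> (new_in uv == new_in wz) = false.
Proof.
move=> vw vz; apply/eqP => /(congr1 (touches v)).
by rewrite !touches_new eqxx orbT (negPf vw) (negPf vz).
Qed.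

(** The endpoints lie in different halves of the new vertices and so cannot be interchanged. *)
Lemma new_in_split_eq m1 m2 (b c : 'I_m1) (t u : 'I_m2)
    (bt : lshift m2 b != rshift m1 t) (cu : lshift m2 c != rshift m1 u) :
  (new_in bt == new_in cu) = (b == c) && (t == u).
Proof.
apply/eqP/andP => [E|[/eqP bc /eqP tu]]; last first.
  by apply: val_inj; rewrite /= bc tu.
have := congr1 (touches (lshift m2 b)) E; have := congr1 (touches (rshift m1 t)) E.
rewrite !touches_new !eqxx orbT !eq_lshift !eq_rshift !eq_lrshift !eq_rlshift !orbF /=.
by move=> <- <-.
Qed.

Lemma touches_nonold m (e : edge (k + m)) v :
  touches v e -> class_index e = rshift _ (tail_index e).
Proof.
rewrite /class_index; case: pickP => // o /eqP <-.
by rewrite touches_old.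
Qed.

Lemma old_in_inj m : injective (old_in m).
Proof.
by move=> o o' /(congr1 val) /(imset_inj (@lshift_inj k m)) /val_inj.
Qed.

Lemma class_index_old m o : class_index (old_in m o) = lshift _ (enum_rank o).
Proof.
rewrite /class_index; case: pickP => [o' /eqP /old_in_inj -> //|/(_ o)].
by rewrite eqxx.
Qed.

Lemma tail_index_mid m i (v : 'I_m) : tail_index (mid_in i v) = lshift 1 i.
Proof.
rewrite /tail_index; case: pickP => [j|/(_ i)]; rewrite !inE ?eqxx //.
by rewrite eq_lrshift orbF => /eqP /lshift_inj ->.
Qed.

Lemma tail_index_new m (u v : 'I_m) (uv : u != v) :
  tail_index (new_in uv) = star_index.
Proof.
by rewrite /tail_index; case: pickP => // j; rewrite !inE !eq_lrshift.
Qed.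

(** An old edge has an endpoint in [k], so the search succeeds. This keeps the [gap] term of [model]
    off old edges. *)
Lemma tail_index_old m o : tail_index (old_in m o) != star_index.
Proof.
rewrite /tail_index; case: pickP => [i _|]; first by rewrite eq_lrshift.
have /cards2P [x [y [_ def_o]]] := valP o.
by move=> /(_ x) /imsetP []; exists x; rewrite // def_o !inE eqxx.
Qed.

Lemma class_index_mid m i (v : 'I_m) :
  class_index (mid_in i v) = rshift _ (lshift 1 i).
Proof. by rewrite (@touches_nonold _ _ v) ?tail_index_mid ?touches_mid. Qed.

Lemma class_index_new m (u v : 'I_m) (uv : u != v) :
  class_index (new_in uv) = rshift _ star_index.
Proof. by rewrite (@touches_nonold _ _ u) ?tail_index_new ?touches_new ?eqxx. Qed.

Definition join_map m1 m2 (g : 'I_m1 -> 'I_m2) (x : 'I_(k + m1)) : 'I_(k + m2) :=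
  match split x with inl i => lshift m2 i | inr v => rshift k (g v) end.

Lemma join_map_l m1 m2 (g : 'I_m1 -> 'I_m2) i :
  join_map g (lshift m1 i) = lshift m2 i.
Proof. by rewrite /join_map (unsplitK (inl i)). Qed.

Lemma join_map_r m1 m2 (g : 'I_m1 -> 'I_m2) v :
  join_map g (rshift k v) = rshift k (g v).
Proof. by rewrite /join_map (unsplitK (inr v)). Qed.

Lemma join_map_inj m1 m2 (g : 'I_m1 -> 'I_m2) :
  injective g -> injective (join_map g).
Proof.
move=> g_inj x y.
case: (split_ordP x) => i ->; case: (split_ordP y) => j ->;
  rewrite ?join_map_l ?join_map_r => /eqP;
  rewrite ?eq_lrshift ?eq_rlshift ?eq_lshift ?eq_rshift //.
  by move/eqP ->.
by move/eqP/g_inj ->.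
Qed.

Lemma edge_map_old m1 m2 (g : 'I_m1 -> 'I_m2) (g_inj : injective g) o :
  edge_map (join_map_inj g_inj) (old_in m1 o) = old_in m2 o.
Proof.
apply: val_inj; rewrite /= -imset_comp; apply: eq_imset => i /=.
exact: join_map_l.
Qed.

End EdgeTypes.

(** * Consequences of stability and invariance for the entries and blocks *)

Section Stability.

Variables (R : realType) (k : nat) (A : forall n : nat, 'M[R]_#|{: edge n}|).

Hypothesis A_sym : forall n : nat, (k <= n)%N -> (A n)^T = A n.
Hypothesis A_restr : forall (n' n : nat) (le_n'n : (n' <= n)%N), (k <= n')%N ->
  forall e f : edge n', entry (A n') e f
    = entry (A n) (edge_widen le_n'n e) (edge_widen le_n'n f).
Hypothesis A_inv : forall n : nat, (k <= n)%N ->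
  forall s : 'S_n, s \in fix_first k n ->
  forall e f : edge n,
    entry (A n) (edge_act s e) (edge_act s f) = entry (A n) e f.

Lemma entry_sym m (e f : edge (k + m)) :
  entry (A (k + m)) e f = entry (A (k + m)) f e.
Proof. by rewrite /entry -{1}(A_sym (leq_addr m k)) mxE. Qed.

(** An injection of new vertices is the inclusion followed by a permutation fixing [k]; [A_restr]
    handles the former and [A_inv] the latter. *)
Lemma entry_edge_map m1 m2 (g : 'I_m1 -> 'I_m2) (g_inj : injective g)
    (e f : edge (k + m1)) :
  entry (A (k + m2)) (edge_map (join_map_inj g_inj) e)
                     (edge_map (join_map_inj g_inj) f)
  = entry (A (k + m1)) e f.
Proof.
have le_m : (k + m1 <= k + m2)%N.
  by rewrite leq_add2l -(card_ord m1) -(card_ord m2); apply: leq_card g_inj.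
have [s sE] := inj_extend_perm le_m (join_map_inj g_inj (k := k)).
have s_fix : s \in fix_first k (k + m2).
  apply/astabP => x; rewrite inE => lt_x; rewrite /= apermE.
  have -> : x = widen_ord le_m (lshift m1 (Ordinal lt_x)) by apply: val_inj.
  by rewrite sE join_map_l; apply: val_inj.
have actE h : edge_map (join_map_inj g_inj) h = edge_act s (edge_widen le_m h).
  by apply: val_inj; rewrite /= -imset_comp; apply: eq_imset => x /=; rewrite sE.
by rewrite !actE A_inv ?leq_addr // -A_restr // leq_addr.
Qed.

Let a := entry (A (k + 4)).
Let C := C_mx a.
Let D := D_mx a.
Let gap := a (e12 k) (e12 k) - 2 * a (e12 k) (e13 k) + a (e12 k) (e34 k).

(** Symmetry of [A] followed by the transposition of the vertices k+1 and k+2; this makes [C22']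
    symmetric. *)
Lemma entry_mid_swap i j :
  a (mid_edge i p1) (mid_edge j p2) = a (mid_edge j p1) (mid_edge i p2).
Proof.
rewrite /a entry_sym -(entry_edge_map (@perm_inj _ (tperm p1 p2))).
congr entry; apply: val_inj;
  by rewrite /= imsetU1 imset_set1 join_map_l join_map_r ?tpermL ?tpermR.
Qed.

Lemma C_mx_sym : C^T = C.
Proof.
rewrite /C /C_mx !tr_block_mx tr_row_mx tr_col_mx !trmxK tr_scalar_mx.
have -> : (C11 a)^T = C11 a by apply/matrixP => e f; rewrite !mxE /a entry_sym.
suff -> : (C22' a)^T = C22' a by [].
by apply/matrixP => i j; rewrite !mxE entry_mid_swap.
Qed.

Lemma D_mx_sym : D^T = D.
Proof.
rewrite /D /D_mx tr_block_mx !trmxK tr_scalar_mx.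
suff -> : (D11 a)^T = D11 a by [].
by apply/matrixP => i j; rewrite !mxE entry_mid_swap /a entry_sym.
Qed.

Lemma CE_sym p q : C p q = C q p. Proof. by rewrite -{1}C_mx_sym mxE. Qed.

Lemma DE_sym p q : D p q = D q p. Proof. by rewrite -{1}D_mx_sym mxE. Qed.

(** * Entries with at least four new vertices, and their closed form *)

Section EntryValues.

Variable m : nat.
Hypothesis m_ge4 : (4 <= m)%N.

(** Two edges have at most four new vertices; sending [p1], [p2], ... to them transports each entry
    from [A (k + 4)]. *)
Lemma new_vertices (t : seq 'I_m) : uniq t -> (size t <= 4)%N ->
  exists2 g : 'I_4 -> 'I_m, injective g &
    forall x0 (i : 'I_4), (i < size t)%N -> g i = nth x0 t i.
Proof. by move=> t_uniq le_t; apply: uniq_extend_inj. Qed.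

Lemma entry_old_old o o' :
  entry (A (k + m)) (old_in m o) (old_in m o') = a (old_edge o) (old_edge o').
Proof.
have [//|//|g g_inj _] := @new_vertices [::].
by rewrite /a -(entry_edge_map g_inj) !edge_map_old.
Qed.

Lemma entry_old_mid o i v :
  entry (A (k + m)) (old_in m o) (mid_in i v) = a (old_edge o) (mid_edge i p1).
Proof.
have [//|//|g g_inj gE] := @new_vertices [:: v].
rewrite /a -(entry_edge_map g_inj) edge_map_old; congr entry.
by apply: val_inj; rewrite /= imsetU1 imset_set1 join_map_l join_map_r (gE v).
Qed.

Lemma entry_old_new o u v (uv : u != v) :
  entry (A (k + m)) (old_in m o) (new_in k uv) = a (old_edge o) (e12 k).
Proof.
have [||g g_inj gE] := @new_vertices [:: u; v]; rewrite //= ?inE ?uv //.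
rewrite /a -(entry_edge_map g_inj) edge_map_old; congr entry.
by apply: val_inj; rewrite /= imsetU1 imset_set1 !join_map_r !(gE v).
Qed.

Lemma entry_mid_mid i j v w :
  entry (A (k + m)) (mid_in i v) (mid_in j w)
  = a (mid_edge i p1) (mid_edge j (if v == w then p1 else p2)).
Proof.
case: eqVneq => [<-|vw].
  have [||g g_inj gE] := @new_vertices [:: v]; rewrite //.
  rewrite /a -(entry_edge_map g_inj); congr entry;
    by apply: val_inj; rewrite /= imsetU1 imset_set1 join_map_l join_map_r (gE v).
have [||g g_inj gE] := @new_vertices [:: v; w]; rewrite //= ?inE ?vw //.
rewrite /a -(entry_edge_map g_inj); congr entry;
  by apply: val_inj; rewrite /= imsetU1 imset_set1 join_map_l join_map_r !(gE v).
Qed.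

Lemma entry_mid_new_in i v w (vw : v != w) :
  entry (A (k + m)) (mid_in i v) (new_in k vw) = a (mid_edge i p1) (e12 k).
Proof.
have [||g g_inj gE] := @new_vertices [:: v; w]; rewrite //= ?inE ?vw //.
rewrite /a -(entry_edge_map g_inj); congr entry;
  by apply: val_inj;
     rewrite /= imsetU1 imset_set1 ?join_map_l !join_map_r !(gE v).
Qed.

Lemma entry_mid_new_notin i v u w (uw : u != w) : v != u -> v != w ->
  entry (A (k + m)) (mid_in i v) (new_in k uw) = a (mid_edge i p1) (e23 k).
Proof.
move=> vu vw; have [||g g_inj gE] := @new_vertices [:: v; u; w];
  rewrite //= ?inE ?negb_or ?vu ?vw ?uw //.
rewrite /a -(entry_edge_map g_inj); congr entry;
  by apply: val_inj;
     rewrite /= imsetU1 imset_set1 ?join_map_l !join_map_r !(gE v).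
Qed.

Lemma entry_new_eq u v (uv : u != v) :
  entry (A (k + m)) (new_in k uv) (new_in k uv) = a (e12 k) (e12 k).
Proof.
have [||g g_inj gE] := @new_vertices [:: u; v]; rewrite //= ?inE ?uv //.
rewrite /a -(entry_edge_map g_inj); congr entry;
  by apply: val_inj; rewrite /= imsetU1 imset_set1 !join_map_r !(gE v).
Qed.

Lemma entry_new_meet u v w (uv : u != v) (uw : u != w) : v != w ->
  entry (A (k + m)) (new_in k uv) (new_in k uw) = a (e12 k) (e13 k).
Proof.
move=> vw; have [||g g_inj gE] := @new_vertices [:: u; v; w];
  rewrite //= ?inE ?negb_or ?uv ?vw ?uw //.
rewrite /a -(entry_edge_map g_inj); congr entry;
  by apply: val_inj; rewrite /= imsetU1 imset_set1 !join_map_r !(gE v).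
Qed.

Lemma entry_new_disjoint u v w z (uv : u != v) (wz : w != z) :
  u != w -> u != z -> v != w -> v != z ->
  entry (A (k + m)) (new_in k uv) (new_in k wz) = a (e12 k) (e34 k).
Proof.
move=> uw uz vw vz; have [||g g_inj gE] := @new_vertices [:: u; v; w; z];
  rewrite //= ?inE ?negb_or ?uv ?uw ?uz ?vw ?vz ?wz //.
rewrite /a -(entry_edge_map g_inj); congr entry;
  by apply: val_inj; rewrite /= imsetU1 imset_set1 !join_map_r !(gE v).
Qed.

(* A pair (e, f) with no common new vertex has the entry prescribed by C, each
   common new vertex adds an entry of D, and [gap] corrects the only remaining
   case, where e = f has two new vertices. *)
Definition model (e f : edge (k + m)) : R :=
  C (class_index e) (class_index f)
  + \sum_v (touches v e)%:R * (touches v f)%:R * D (tail_index e) (tail_index f)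
  + (gap *+ (tail_index e == star_index k)) *+ (e == f).

Lemma model_sym e f : model e f = model f e.
Proof.
rewrite /model CE_sym; congr (_ + _ + _); last first.
  by rewrite (eq_sym f); case: (eqVneq e f) => [->|].
by apply: eq_bigr => v _; rewrite DE_sym (mulrC (touches v e)%:R).
Qed.

Lemma sum_eq_mul (v : 'I_m) (F : 'I_m -> R) : \sum_w (w == v)%:R * F w = F v.
Proof.
rewrite (bigD1 v) //= eqxx mul1r big1 ?addr0 // => w /negPf ->.
by rewrite mul0r.
Qed.

Lemma sum_touches_old (o : edge k) (f : edge (k + m)) x :
  \sum_v (touches v (old_in m o))%:R * (touches v f)%:R * x = 0 :> R.
Proof. by rewrite big1 // => v _; rewrite touches_old !mul0r. Qed.

Lemma sum_touches_mid (i : 'I_k) v (f : edge (k + m)) x :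
  \sum_w (touches w (mid_in i v))%:R * (touches w f)%:R * x
  = (touches v f)%:R * x :> R.
Proof.
rewrite -(sum_eq_mul v (fun w => (touches w f)%:R * x)).
by apply: eq_bigr => w _; rewrite touches_mid mulrA.
Qed.

Lemma sum_touches_new u v (uv : u != v) (f : edge (k + m)) x :
  \sum_w (touches w (new_in k uv))%:R * (touches w f)%:R * x
  = ((touches u f)%:R + (touches v f)%:R) * x :> R.
Proof.
rewrite mulrDl -(sum_eq_mul u (fun w => (touches w f)%:R * x)).
rewrite -(sum_eq_mul v (fun w => (touches w f)%:R * x)) -big_split /=.
apply: eq_bigr => w _; rewrite touches_new -mulrDl -mulrA; congr (_ * _).
by have [->|_] := eqVneq w u; rewrite ?(negPf uv) ?addr0 ?add0r.
Qed.

Lemma C_old_old o o' :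
  C (lshift _ (enum_rank o)) (lshift _ (enum_rank o')) = a (old_edge o) (old_edge o').
Proof. by rewrite /C /C_mx block_mxEul mxE !enum_rankK. Qed.

Lemma C_old_mid o i :
  C (lshift _ (enum_rank o)) (rshift _ (lshift 1 i)) = a (old_edge o) (mid_edge i p1).
Proof. by rewrite /C /C_mx block_mxEur row_mxEl mxE !enum_rankK. Qed.

Lemma C_old_new o :
  C (lshift _ (enum_rank o)) (rshift _ (star_index k)) = a (old_edge o) (e12 k).
Proof. by rewrite /C /C_mx block_mxEur row_mxEr mxE !enum_rankK. Qed.

Lemma C_mid_mid i j :
  C (rshift _ (lshift 1 i)) (rshift _ (lshift 1 j))
  = a (mid_edge i p1) (mid_edge j p2).
Proof. by rewrite /C /C_mx block_mxEdr block_mxEul mxE. Qed.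

Lemma C_mid_new i :
  C (rshift _ (lshift 1 i)) (rshift _ (star_index k)) = a (mid_edge i p1) (e23 k).
Proof. by rewrite /C /C_mx block_mxEdr block_mxEur mxE. Qed.

Lemma C_new_new :
  C (rshift _ (star_index k)) (rshift _ (star_index k)) = a (e12 k) (e34 k).
Proof. by rewrite /C /C_mx !block_mxEdr mxE eqxx. Qed.

Lemma D_mid_mid i j :
  D (lshift 1 i) (lshift 1 j)
  = a (mid_edge i p1) (mid_edge j p1) - a (mid_edge i p1) (mid_edge j p2).
Proof. by rewrite /D /D_mx block_mxEul mxE. Qed.

Lemma D_mid_new i :
  D (lshift 1 i) (star_index k)
  = a (mid_edge i p1) (e12 k) - a (mid_edge i p1) (e23 k).
Proof. by rewrite /D /D_mx block_mxEur mxE. Qed.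

Lemma D_new_new :
  D (star_index k) (star_index k) = a (e12 k) (e13 k) - a (e12 k) (e34 k).
Proof. by rewrite /D /D_mx block_mxEdr mxE eqxx. Qed.

Lemma model_old o f :
  model (old_in m o) f = C (lshift _ (enum_rank o)) (class_index f).
Proof.
rewrite /model class_index_old sum_touches_old (negPf (tail_index_old _ _)).
by rewrite mulr0n mul0rn !addr0.
Qed.

Lemma model_mid i v f :
  model (mid_in i v) f = C (rshift _ (lshift 1 i)) (class_index f)
    + (touches v f)%:R * D (lshift 1 i) (tail_index f).
Proof.
rewrite /model class_index_mid sum_touches_mid tail_index_mid eq_lrshift.
by rewrite mulr0n mul0rn addr0.
Qed.

Lemma model_new u v (uv : u != v) w z (wz : w != z) :
  model (new_in k uv) (new_in k wz)
  = a (e12 k) (e34 k)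
    + (((u == w) || (u == z))%:R + ((v == w) || (v == z))%:R)
      * (a (e12 k) (e13 k) - a (e12 k) (e34 k))
    + gap *+ (new_in k uv == new_in k wz).
Proof.
rewrite /model !class_index_new sum_touches_new !tail_index_new eqxx.
by rewrite C_new_new D_new_new !touches_new.
Qed.

Lemma entry_new_meet_model u v w (uv : u != v) (uw : u != w) :
  entry (A (k + m)) (new_in k uv) (new_in k uw) = model (new_in k uv) (new_in k uw).
Proof.
rewrite model_new; have [eq_vw|vw] := eqVneq v w; last first.
  have vu : v != u by rewrite eq_sym.
  rewrite entry_new_meet // new_in_neq // eqxx (negPf vu) /=.
  by rewrite !addr0 mul1r subrKC.
move: uw; rewrite -eq_vw => uw; rewrite (bool_irrelevance uw uv) entry_new_eq.
(* Equal edges share two new vertices, so [D22] is counted twice; [gap] is exactly what then remains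
   up to the diagonal entry. *)
by rewrite !eqxx orbT /gap /= mulr1n; ring.
Qed.

Lemma entry_mid_new_model i v w z (wz : w != z) :
  entry (A (k + m)) (mid_in i v) (new_in k wz) = model (mid_in i v) (new_in k wz).
Proof.
rewrite model_mid class_index_new tail_index_new touches_new C_mid_new D_mid_new.
have [eq_vw|vw] := eqVneq v w.
  by move: wz; rewrite -eq_vw => wz; rewrite entry_mid_new_in mul1r subrKC.
have [eq_vz|vz] := eqVneq v z; last first.
  by rewrite entry_mid_new_notin // mul0r addr0.
move: wz; rewrite -eq_vz => wz.
by rewrite (new_inC k wz vw) entry_mid_new_in mul1r subrKC.
Qed.

Lemma entry_new_new_model u v w z (uv : u != v) (wz : w != z) :
  entry (A (k + m)) (new_in k uv) (new_in k wz) = model (new_in k uv) (new_in k wz).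
Proof.
(* In each case with a common vertex, [new_inC] moves that vertex to the front of both edges. *)
have [eq_uw|uw] := eqVneq u w.
  by move: wz; rewrite -eq_uw => wz; apply: entry_new_meet_model.
have [eq_uz|uz] := eqVneq u z.
  by move: wz; rewrite -eq_uz => wz; rewrite (new_inC k wz uw) entry_new_meet_model.
have vu : v != u by rewrite eq_sym.
have [eq_vw|vw] := eqVneq v w.
  by move: wz; rewrite -eq_vw => wz; rewrite (new_inC k uv vu) entry_new_meet_model.
have [eq_vz|vz] := eqVneq v z.
  move: wz; rewrite -eq_vz => wz.
  by rewrite (new_inC k uv vu) (new_inC k wz vw) entry_new_meet_model.
rewrite entry_new_disjoint // model_new new_in_neq //.
by rewrite (negPf uw) (negPf uz) (negPf vw) (negPf vz) !addr0 mul0r addr0.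
Qed.

Lemma entry_model (e f : edge (k + m)) : entry (A (k + m)) e f = model e f.
Proof.
case: (edgeP e) => [o|i v|u v uv]; case: (edgeP f) => [o'|j w|w z wz].
- by rewrite model_old class_index_old C_old_old entry_old_old.
- by rewrite model_old class_index_mid C_old_mid entry_old_mid.
- by rewrite model_old class_index_new C_old_new entry_old_new.
- by rewrite entry_sym model_sym model_old class_index_mid C_old_mid entry_old_mid.
- rewrite model_mid class_index_mid tail_index_mid touches_mid entry_mid_mid.
  rewrite C_mid_mid D_mid_mid.
  by case: eqVneq => _; rewrite ?mul1r ?mul0r ?addr0 ?subrKC.
- exact: entry_mid_new_model.
- by rewrite entry_sym model_sym model_old class_index_new C_old_new entry_old_new.
- by rewrite entry_sym model_sym entry_mid_new_model.
- exact: entry_new_new_model.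
Qed.

End EntryValues.

(** * Sufficiency of the three conditions *)

Lemma kpsd_entry n : kpsd (A n) <-> kpsd (entry (A n)).
Proof.
split=> [/(kpsd_comp (fun e : edge n => enum_rank e)) //|].
move=> /(kpsd_comp (fun i : 'I_#|{: edge n}| => enum_val i)) pA.
by apply: eq_kpsd pA _ => i j; rewrite /entry !enum_valK.
Qed.

(** The summands are a pullback of [C], a sum over new vertices of pullbacks of [D] weighted by
    incidence, and a nonnegative diagonal. *)
Lemma kpsd_model m : 0 <= gap -> kpsd C -> kpsd D -> kpsd (@model m).
Proof.
move=> gap_ge0 C_ge0 D_ge0; apply: kpsd_add; first apply: kpsd_add.
- exact: kpsd_comp.
- apply: kpsd_sum => v.
  apply: (@kpsd_weight _ _ (fun e => (touches v e)%:R)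
            (fun e f => D (tail_index e) (tail_index f))).
  exact: kpsd_comp.
- by apply: kpsd_diag => e; rewrite mulrn_wge0.
Qed.

(** The closed form requires four new vertices, so four are added first and the kernel is then
    pulled back along the inclusion. *)
Lemma kpsd_entry_of_blocks m :
  0 <= gap -> kpsd C -> kpsd D -> kpsd (entry (A (k + m))).
Proof.
move=> gap_ge0 C_ge0 D_ge0.
pose w := edge_map (join_map_inj (k := k) (@lshift_inj m 4)).
apply: eq_kpsd (kpsd_comp w (@kpsd_model (m + 4) gap_ge0 C_ge0 D_ge0)) _ => e f.
by rewrite -entry_model ?leq_addl // entry_edge_map.
Qed.

(** * Necessity of the three conditions, by test families of edges *)

Section Necessity.

Hypothesis A_psd : forall m, kpsd (entry (A (k + m))).

(* Spreading the weight of a class over N copies that share no new vertex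
   leaves the C-part of the form unchanged and divides the rest by N. *)
Definition matching_edge N (pt : 'I_(#|{: edge k}| + (k + 1)) * 'I_N) :
    edge (k + (N + N)) :=
  match split pt.1 with
  | inl o => old_in (N + N) (enum_val o)
  | inr q =>
    match split q with
    | inl i => mid_in i (lshift N pt.2)
    | inr _ => new_in k (mid_in_subproof pt.2 pt.2)
    end
  end.

(** The excess over [C] within one copy: non-old edges share one new vertex, which gives one [D];
    two star edges coincide, which gives a second [D] and [gap]. *)
Definition matching_defect (p q : 'I_(#|{: edge k}| + (k + 1))) : R :=
  match split p, split q with
  | inr p', inr q' =>
    D p' q' + (D p' q' + gap) *+ ((p' == star_index k) && (q' == star_index k))
  | _, _ => 0
  end.

Lemma matching_defectC p q : matching_defect p q = matching_defect q p.
Proof.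
rewrite /matching_defect; case: split => p'; case: split => q' //.
by rewrite DE_sym andbC.
Qed.

Lemma matching_edgeE N p (t : 'I_N) :
  [\/ exists o, p = lshift _ (enum_rank o) /\ matching_edge (p, t) = old_in _ o,
      exists i, p = rshift _ (lshift 1 i)
                /\ matching_edge (p, t) = mid_in i (lshift N t)
    | p = rshift _ (star_index k)
      /\ matching_edge (p, t) = new_in k (mid_in_subproof t t)].
Proof.
rewrite /matching_edge /=; case: split_ordP => [o ->|q ->].
  by constructor 1; exists (enum_val o); rewrite enum_valK.
case: split_ordP => [i ->|j ->]; first by constructor 2; exists i.
by constructor 3; rewrite ord1.
Qed.

Lemma model_matching N (x y : 'I_(#|{: edge k}| + (k + 1)) * 'I_N) :
  model (matching_edge x) (matching_edge y)
  = C x.1 y.1 + matching_defect x.1 y.1 *+ (x.2 == y.2).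
Proof.
case: x y => p t [q u] /=.
have defect0 o r : matching_defect (lshift _ o) r = 0.
  by rewrite /matching_defect (unsplitK (inl o)).
have defectE p' q' : matching_defect (rshift _ p') (rshift _ q')
    = D p' q' + (D p' q' + gap) *+ ((p' == star_index k) && (q' == star_index k)).
  by rewrite /matching_defect (unsplitK (inr p')) (unsplitK (inr q')).
case: (matching_edgeE p t) => [[o [-> ->]]|[i [-> ->]]|[-> ->]];
case: (matching_edgeE q u) => [[o' [-> ->]]|[j [-> ->]]|[-> ->]].
- by rewrite defect0 mul0rn addr0 model_old class_index_old.
- by rewrite defect0 mul0rn addr0 model_old class_index_mid.
- by rewrite defect0 mul0rn addr0 model_old class_index_new.
- rewrite matching_defectC defect0 mul0rn addr0 model_sym model_old.
  by rewrite class_index_mid CE_sym.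
- rewrite defectE model_mid class_index_mid tail_index_mid touches_mid.
  by rewrite eq_lshift eq_lrshift mulr0n addr0 mulr_natl.
- rewrite defectE model_mid class_index_new tail_index_new touches_new.
  by rewrite eq_lshift !eq_lrshift mulr0n addr0 orbF mulr_natl.
- rewrite matching_defectC defect0 mul0rn addr0 model_sym model_old.
  by rewrite class_index_new CE_sym.
- rewrite matching_defectC model_sym CE_sym defectE model_mid class_index_new.
  rewrite tail_index_new touches_new (eq_sym t).
  by rewrite eq_lshift !eq_lrshift mulr0n addr0 orbF mulr_natl.
- rewrite defectE model_new C_new_new D_new_new new_in_split_eq.
  rewrite eq_lshift eq_rshift eq_lrshift eq_rlshift orbF !eqxx /=.
  by case: eqP => _; rewrite ?mulr0n ?mulr1n; ring.
Qed.

Lemma kpsd_C : kpsd C.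
Proof.
apply: (@kpsd_limit _ _ _ matching_defect) => N N_gt1.
apply: eq_kpsd (kpsd_comp (@matching_edge N) (@A_psd (N + N)%N)) _ => x y.
(* [1 < N] provides the four new vertices required by [entry_model]. *)
by rewrite entry_model ?model_matching // (leq_add N_gt1 N_gt1).
Qed.

(* Giving opposite weights to the copies b = 0, 1 cancels every term that does
   not involve the common vertex b, which leaves D and [gap]. *)
Definition broom_edge N (x : ('I_(k + 1) * 'I_N) * 'I_2) : edge (k + (2 + N)) :=
  match split x.1.1 with
  | inl i => mid_in i (lshift N x.2)
  | inr _ => new_in k (mid_in_subproof x.2 x.1.2)
  end.

Definition star_mask (p q : 'I_(k + 1)) : R :=
  gap *+ ((p == star_index k) && (q == star_index k)).

(** The part of the entry independent of the copies in ['I_2]; its [D] term comes from star edges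
    with the same outer endpoint. *)
Definition broom_base N (x y : 'I_(k + 1) * 'I_N) : R :=
  C (rshift _ x.1) (rshift _ y.1)
  + D x.1 y.1 *+ [&& x.1 == star_index k, y.1 == star_index k & x.2 == y.2].

Definition broom_defect N (x y : 'I_(k + 1) * 'I_N) : R :=
  D x.1 y.1 + star_mask x.1 y.1 *+ (x.2 == y.2).

Lemma model_broom N (x y : ('I_(k + 1) * 'I_N) * 'I_2) :
  model (broom_edge x) (broom_edge y)
  = broom_base x.1 y.1 + broom_defect x.1 y.1 *+ (x.2 == y.2).
Proof.
case: x y => [[p t] b] [[q u] c]; rewrite /broom_edge /broom_base /broom_defect /=.
rewrite /star_mask; case: split_ordP => i ->; case: split_ordP => j ->;
  rewrite ?(ord1 i) ?(ord1 j) -?/(star_index k) ?eq_lrshift ?eqxx /=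
    ?andbF ?mulr0n ?mul0rn ?addr0.
- rewrite model_mid class_index_mid tail_index_mid touches_mid.
  by rewrite eq_lshift mulr_natl.
- rewrite model_mid class_index_new tail_index_new touches_new.
  by rewrite eq_lshift !eq_lrshift orbF mulr_natl.
- rewrite model_sym CE_sym DE_sym model_mid class_index_new.
  rewrite tail_index_new touches_new (eq_sym b).
  by rewrite eq_lshift !eq_lrshift orbF mulr_natl.
- rewrite model_new C_new_new D_new_new new_in_split_eq.
  rewrite eq_lshift eq_rshift eq_lrshift eq_rlshift orbF /=.
  by do 2 case: eqP => _; rewrite ?mulr0n ?mulr1n; ring.
Qed.

Lemma kpsd_broom N : (1 < N)%N -> kpsd (@broom_defect N).
Proof.
move=> N_gt1; apply: (@kpsd_diff _ _ 'I_2 (@broom_base N) _ ord0 ord_max) => //.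
apply: eq_kpsd (kpsd_comp (@broom_edge N) (@A_psd (2 + N)%N)) _ => x y.
by rewrite entry_model ?model_broom.
Qed.

(** Averaging over the N outer endpoints makes the [star_mask] part of [broom_defect] negligible. *)
Lemma kpsd_D : kpsd D.
Proof. by apply: (@kpsd_limit _ _ _ star_mask) => N /kpsd_broom. Qed.

Lemma gap_ge0 : 0 <= gap.
Proof.
have : kpsd star_mask.
  (* With N = 2, a second difference, now between the two outer endpoints, cancels [D]. *)
  by apply: (@kpsd_diff _ _ 'I_2 D _ ord0 ord_max) => //; apply: kpsd_broom.
move/(kpsd_comp (fun _ : unit => star_index k)) => /(_ (fun=> 1)).
by rewrite !big_const card_unit /= !addr0 !mul1r /star_mask !eqxx.
Qed.

End Necessity.

End Stability.

(** * The equivalence for the whole sequence *)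

Theorem theorem1p3 (R : realType) (k : nat)
  (A : forall n : nat, 'M[R]_#|{: edge n}|)
  (A_sym : forall n : nat, (k <= n)%N -> (A n)^T = A n)
  (A_restr : forall (n' n : nat) (le_n'n : (n' <= n)%N), (k <= n')%N ->
     forall e f : edge n',
       entry (A n') e f
       = entry (A n) (edge_widen le_n'n e) (edge_widen le_n'n f))
  (A_inv : forall n : nat, (k <= n)%N ->
     forall s : 'S_n, s \in fix_first k n ->
     forall e f : edge n,
       entry (A n) (edge_act s e) (edge_act s f) = entry (A n) e f) :
  let a := entry (A (k + 4)%N) in
  (forall n : nat, (k <= n)%N -> psd (A n)) <->
  [/\ 0 <= a (e12 k) (e12 k) - 2 * a (e12 k) (e13 k) + a (e12 k) (e34 k),
      psd (C_mx a) &
      psd (D_mx a)].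
Proof.
split=> [A_psd|[gap_ge0 /psd_kpsd [_ C_psd] /psd_kpsd [_ D_psd]] n le_kn].
  have A_kpsd m : kpsd (entry (A (k + m))).
    by apply/kpsd_entry; have /psd_kpsd [] := A_psd _ (leq_addr m k).
  split; first exact: gap_ge0.
    by apply/psd_kpsd; split; [apply: C_mx_sym | apply: kpsd_C].
  by apply/psd_kpsd; split; [apply: D_mx_sym | apply: kpsd_D].
apply/psd_kpsd; split; first exact: A_sym.
by rewrite -(subnKC le_kn); apply/kpsd_entry; apply: kpsd_entry_of_blocks.
Qed.
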